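(* Let $M$ be a nonempty topological manifold and let $G\subset \mathrm{Homeo}(M)$ be a subgroup satisfying the local perturbations property. If $\tau$ is any Polish group topology on $G$, then the generic pair $(f,g)\in G\times G$ (with respect to the product topology $\tau\times\tau$) generates a free subgroup; that is, the set of pairs $(f,g)\in G\times G$ such that $w(f,g)\neq \mathrm{id}$ for every nontrivial reduced word $w$ in the free group $F_2$ on two generators is comeager in $G\times G$.
   Context: $\mathrm{Homeo}(M)$ is the group of all homeomorphisms of $M$. A subgroup $G\subset\mathrm{Homeo}(M)$ satisfies the local perturbations property if for each open set $U\subset M$ and each point $y\in U$, the set $\{f(y) : f\in G,\ f|_{M\setminus U}=\mathrm{id}\}$ is uncountable. A Polish group topology is a separable, completely metrizable topology making $G$ a topological group. A property holds for the generic element of a Polish space if it holds on a comeager set (one containing a countable intersection of dense open sets). For a word $w\in F_2$, $w(f,g)$ denotes the element of $G$ obtained by substituting $f$ and $g$ for the two free generators; ''$(f,g)$ generates a free subgroup'' means that $f,g$ freely generate a free group of rank 2. *)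

(* Defs.v *)
(* MathComp-Analysis; the real numbers are an arbitrary realType. *)
From HB Require Import structures.
From mathcomp Require Import all_boot all_order all_algebra.
From mathcomp Require Import all_classical all_reals all_analysis.
Import Order.TTheory GRing.Theory Num.Theory.
Import numFieldNormedType.Exports.

Set Implicit Arguments.
Unset Strict Implicit.
Unset Printing Implicit Defensive.

Local Open Scope classical_set_scope.

(* U and V are open and phi restricts to a homeomorphism from U onto V, with
   inverse the restriction of psi; the values of phi outside U and of psi
   outside V are irrelevant. *)
Definition open_homeomorphism (X Y : topologicalType) (U : set X) (V : set Y)
    (phi : X -> Y) (psi : Y -> X) : Prop :=
  [/\ open U /\ open V,
      set_fun U V phi /\ set_fun V U psi,
      {in U, cancel phi psi} /\ {in V, cancel psi phi} &
      {within U, continuous phi} /\ {within V, continuous psi}].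

Definition locally_euclidean (R : realType) (n : nat) (M : topologicalType) :=
  forall x : M, exists (U : set M) (V : set 'rV[R]_n)
    (phi : M -> 'rV[R]_n) (psi : 'rV[R]_n -> M),
    U x /\ open_homeomorphism U V phi psi.

Definition topological_manifold (R : realType) (n : nat)
    (M : topologicalType) : Prop :=
  [/\ hausdorff_space M, @second_countable M & locally_euclidean R n M].

Section Homeo.
Variable M : topologicalType.

Record homeo : Type := Homeo {
  homeo_fun :> M -> M;
  homeo_inv : M -> M;
  homeo_funK : cancel homeo_fun homeo_inv;
  homeo_invK : cancel homeo_inv homeo_fun;
  homeo_fun_continuous : continuous homeo_fun;
  homeo_inv_continuous : continuous homeo_inv }.

Lemma homeoP (f g : homeo) : f =1 g -> f = g.
Proof.
case: f g => [f f' fK f'K cf cf'] [g g' gK g'K cg cg'] /= fg.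
have {}fg : f = g by exact/funext.
move: fK f'K cf cf'; rewrite fg => fK f'K cf cf'.
have f'g' : f' = g' by apply/funext => x; rewrite -{1}(g'K x) fK.
move: fK f'K cf'; rewrite f'g' => fK f'K cf'.
by congr Homeo; exact: Prop_irrelevance.
Qed.

HB.instance Definition _ := gen_eqMixin homeo.
HB.instance Definition _ := gen_choiceMixin homeo.

Lemma id_continuous : continuous (@id M).
Proof. by move=> x; exact: cvg_id. Qed.

Definition homeo_one : homeo :=
  @Homeo id id (fun=> erefl) (fun=> erefl) id_continuous id_continuous.

Lemma continuous_compM (f g : M -> M) :
  continuous f -> continuous g -> continuous (f \o g).
Proof. by move=> cf cg x; apply: continuous_comp; [exact: cg|exact: cf]. Qed.

Definition homeo_mul (f g : homeo) : homeo :=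
  @Homeo (homeo_fun f \o homeo_fun g) (homeo_inv g \o homeo_inv f)
    (can_comp (homeo_funK f) (homeo_funK g))
    (can_comp (homeo_invK g) (homeo_invK f))
    (continuous_compM (homeo_fun_continuous (h := f))
                      (homeo_fun_continuous (h := g)))
    (continuous_compM (homeo_inv_continuous (h := g))
                      (homeo_inv_continuous (h := f))).

Definition homeo_invg (f : homeo) : homeo :=
  Homeo (homeo_invK f) (homeo_funK f)
    (homeo_inv_continuous (h := f)) (homeo_fun_continuous (h := f)).

Lemma homeo_mulA : associative homeo_mul.
Proof. by move=> f g h; exact: homeoP. Qed.
Lemma homeo_mul1g : left_id homeo_one homeo_mul.
Proof. by move=> f; exact: homeoP. Qed.
Lemma homeo_mulg1 : right_id homeo_one homeo_mul.
Proof. by move=> f; exact: homeoP. Qed.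
Lemma homeo_mulVg : left_inverse homeo_one homeo_invg homeo_mul.
Proof. by move=> f; apply: homeoP => x /=; rewrite homeo_funK. Qed.
Lemma homeo_mulgV : right_inverse homeo_one homeo_invg homeo_mul.
Proof. by move=> f; apply: homeoP => x /=; rewrite homeo_invK. Qed.

HB.instance Definition _ := isGroup.Build homeo homeo_mulA
  homeo_mul1g homeo_mulg1 homeo_mulVg homeo_mulgV.

End Homeo.

(* A subgroup is given by a boolean predicate closed under the group
   operations; thanks to classical reasoning ([asbool]) this covers every
   subgroup. *)
Definition subgroup (gT : groupType) (G : groupClosed gT) : Type :=
  {x : gT | x \in G}.

Section Subgroup.
Variables (gT : groupType) (G : groupClosed gT).

HB.instance Definition _ := SubChoice.on (subgroup G).

Lemma subgroup_closed : group_closed (fun x : gT => x \in G).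
Proof.
by split=> [|x y Gx Gy]; [exact: gpred1 | apply: gpredM; rewrite ?gpredV].
Qed.

HB.instance Definition _ :=
  SubChoice_isSubGroup.Build gT (fun x => x \in G) (subgroup G) subgroup_closed.

End Subgroup.

Definition local_perturbations (M : topologicalType)
    (G : groupClosed (homeo M)) : Prop :=
  forall (U : set M) (y : M), open U -> U y ->
    ~ countable [set f y | f in
        [set f : homeo M | f \in G /\ forall x, ~ U x -> f x = x]].

Definition separable (T : topologicalType) : Prop :=
  exists2 D : set T, countable D & dense D.

(* [m] is a structure of metric space on the carrier of [T]. *)
Definition completely_metrizable (R : realType) (T : topologicalType) : Prop :=
  exists m : Metric R T, let X : metricType R := Metric.Pack m in
    (forall x : T, @nbhs T T x = @nbhs X X x) /\
    (forall F : set_system X,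
       ProperFilter F -> cauchy F -> exists l : X, F --> l).

(* [tau] is a topological space structure on the carrier of [gT], and
   [Topological.Pack tau] is the resulting topological space. *)
Definition group_topology (gT : groupType) (tau : Topological gT) : Prop :=
  let T : topologicalType := Topological.Pack tau in
  continuous (fun p : T * T => ((p.1 : gT) * (p.2 : gT))%g : T) /\
  continuous (fun x : T => ((x : gT)^-1)%g : T).

Definition polish_group_topology (R : realType) (gT : groupType)
    (tau : Topological gT) : Prop :=
  [/\ group_topology tau, separable (Topological.Pack tau) &
      completely_metrizable R (Topological.Pack tau)].

Definition comeager (T : topologicalType) (A : set T) : Prop :=
  exists O : nat -> set T,
    (forall k, open (O k) /\ dense (O k)) /\ \bigcap_k O k `<=` A.

(* Words in the generators of F_2 and their inverses: the first component of a
   letter selects the generator, the second one tells whether it is inverted. *)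
Definition letter : Type := (bool * bool)%type.

Definition inverse_letters (a b : letter) : bool :=
  (a.1 == b.1) && (a.2 != b.2).

Definition reduced (w : seq letter) : bool :=
  sorted (fun a b => ~~ inverse_letters a b) w.

Definition letter_eval (gT : groupType) (f g : gT) (a : letter) : gT :=
  let x := if a.1 then g else f in if a.2 then (x^-1)%g else x.

Definition word_eval (gT : groupType) (f g : gT) (w : seq letter) : gT :=
  (\prod_(a <- w) letter_eval f g a)%g.

Definition generates_free_subgroup (gT : groupType) (f g : gT) : Prop :=
  forall w : seq letter, reduced w -> w != [::] -> word_eval f g w <> 1%g.

(* Main.v *)
Require Import Defs.
From mathcomp Require Import all_boot all_order all_algebra.
From mathcomp Require Import all_classical all_reals all_analysis.

(** Since there are countably many words, and for each of them the pairs with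
    w(f, g) <> 1 form an open set ([word_eval] is continuous and points are
    closed), it suffices to see that this set is dense for every nontrivial
    reduced word w. The topology is unrelated to the action on M; the two are
    linked by counting only. Countably many translates of a neighbourhood of 1
    cover the group, so if a subgroup moves a point y to uncountably many places,
    then so do its elements that are close to 1
    ([uncountable_orbit_near1]). With the local perturbations property this gives
    elements h arbitrarily close to 1, supported near y, whose values h y avoid
    any given finite set.

    Fix a point x and apply the letters of w to it successively, beginning with
    the last one. By induction on w the pair (f, g) can be moved slightly so that
    the points visited are pairwise distinct ([dense_uniq_trajectory]). In the inductive step, w = a w', the trajectory of
    w' ends at y and is already injective; precomposing the letter a with an h
    supported away from the other visited points leaves this trajectory
    unchanged ([trajectory_perturb]), because w does not begin with a letter
    followed by its inverse, and sends y to a new point for a suitable h. When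
    w is not empty, injectivity of the trajectory says in particular that w(f, g)
    moves x. *)

Local Open Scope classical_set_scope.

Set Implicit Arguments.
Unset Strict Implicit.

(** * Continuity of words in a topological group *)

Section GroupTopology.
Variables (gT : groupType) (tau : Topological gT).
Let T : topologicalType := Topological.Pack tau.
Hypothesis tauG : group_topology tau.

Lemma group_continuousM (X : topologicalType) (u v : X -> T) :
  continuous u -> continuous v ->
  continuous (fun x => ((u x : gT) * (v x : gT))%g : T).
Proof.
move=> cu cv x.
apply: (@continuous_comp _ _ _ (fun x => (u x, v x) : T * T)
  (fun p : T * T => ((p.1 : gT) * (p.2 : gT))%g : T)).
  by apply: cvg_pair; [exact: cu|exact: cv].
by case: tauG => cM _; exact: cM.
Qed.

Lemma group_continuousV (X : topologicalType) (u : X -> T) :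
  continuous u -> continuous (fun x => ((u x : gT)^-1)%g : T).
Proof.
move=> cu x; apply: (@continuous_comp _ _ _ u (fun x : T => ((x : gT)^-1)%g : T)).
  exact: cu.
by case: tauG => _ cV; exact: cV.
Qed.

Lemma letter_eval_continuous (a : letter) :
  continuous (fun p : T * T => letter_eval (p.1 : gT) (p.2 : gT) a : T).
Proof.
case: a => [[] []]; rewrite /letter_eval /=.
- by apply: (@group_continuousV _ (fun p : T * T => p.2)) => p; exact: cvg_snd.
- by move=> p; exact: cvg_snd.
- by apply: (@group_continuousV _ (fun p : T * T => p.1)) => p; exact: cvg_fst.
- by move=> p; exact: cvg_fst.
Qed.

Lemma word_eval_continuous (w : seq letter) :
  continuous (fun p : T * T => word_eval (p.1 : gT) (p.2 : gT) w : T).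
Proof.
elim: w => [|a w IHw].
  rewrite (_ : (fun _ => _) = (fun=> 1%g : T)); first by move=> p; exact: cvg_cst.
  by apply/funext => p; rewrite /word_eval big_nil.
rewrite (_ : (fun _ => _) = (fun p : T * T =>
    (letter_eval (p.1 : gT) (p.2 : gT) a *
     word_eval (p.1 : gT) (p.2 : gT) w)%g : T)).
  exact: (@group_continuousM (T * T)%type
    (fun p : T * T => letter_eval (p.1 : gT) (p.2 : gT) a)
    (fun p : T * T => word_eval (p.1 : gT) (p.2 : gT) w)
    (@letter_eval_continuous a) IHw).
by apply/funext => p; rewrite /word_eval big_cons.
Qed.

End GroupTopology.

(** [completely_metrizable] only provides a metric on the same carrier, so the
    separation axiom has to be carried over along the equality of the
    neighbourhoods. *)
Lemma completely_metrizable_closed1 (R : realType) (T : topologicalType) (t : T) :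
  completely_metrizable R T -> closed [set t].
Proof.
move=> [m [nbhsE _]]; rewrite -openC openE => x xt; rewrite /interior nbhsE.
have /accessible_closed_set1/(_ t) := hausdorff_accessible
  (@metric_hausdorff R (Metric.Pack m)).
by rewrite -openC openE; exact.
Qed.

(** * Small elements with uncountable orbits *)

Section SmallPerturbations.
Variables (gT : groupType) (tau : Topological gT).
Let T : topologicalType := Topological.Pack tau.

(** Choose V and W around 1 with V^-1 W inside N. By separability H is covered by
    countably many pieces H `&` d (V `&` W), so some piece sends y to
    uncountably many points. Dividing that piece on the left by one of its
    elements f0 puts it inside N, and this only transports the set of
    images of y by f0^-1. *)
Lemma uncountable_orbit_near1 (M : Type) (act : gT -> M -> M) (H : set gT)
    (N : set T) (y : M) :
  group_topology tau -> separable T ->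
  (forall f g x, act (f * g)%g x = act f (act g x)) ->
  (forall x, act 1%g x = x) ->
  (forall f g, H f -> H g -> H (f^-1 * g)%g) ->
  ~ countable [set act f y | f in H] ->
  nbhs (1%g : T) N ->
  ~ countable [set act h y | h in [set h : gT | H h /\ N h]].
Proof.
move=> tauG [D cD dD] actM act1 HG ncH N1 cN; apply: ncH.
have NVM : nbhs ((1%g, 1%g) : T * T)
    [set p : T * T | N ((p.1 : gT)^-1 * (p.2 : gT))%g].
  have c : continuous (fun p : T * T => ((p.1 : gT)^-1 * (p.2 : gT))%g : T).
    apply: (@group_continuousM _ _ tauG _ (fun p : T * T => ((p.1 : gT)^-1)%g) snd).
      by apply: (@group_continuousV _ _ tauG _ fst) => p; exact: cvg_fst.
    by move=> p; exact: cvg_snd.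
  by apply: c; rewrite /= invg1 mulg1.
case: NVM => -[V W] /= [V1 W1] VWN.
pose piece (d : gT) := [set f : gT | H f /\ (V `&` W) (d^-1 * f)%g].
apply: (@sub_countable _ _ _ (\bigcup_(d in D) [set act f y | f in piece d])).
  apply: subset_card_le => _ [f Hf <-].
  (* The d with d^-1 f near 1 form a neighbourhood of f, which meets D. *)
  have : nbhs (f : T) [set d : T | (V `&` W) ((d : gT)^-1 * f)%g].
    have c : continuous (fun d : T => ((d : gT)^-1 * f)%g : T).
      apply: (@group_continuousM _ _ tauG T (fun d => ((d : gT)^-1)%g) (fun=> f)).
        by apply: (@group_continuousV _ _ tauG T id) => p; exact: cvg_id.
      by move=> p; exact: cvg_cst.
    by apply: c; rewrite /= mulVg; exact: filterI.
  rewrite nbhsE => -[B [oB Bf] BVW].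
  have [d [/BVW Vd Dd]] := dD B (ex_intro _ _ Bf) oB.
  by exists d => //; exists f.
apply: bigcup_countable => [//|d Dd].
have [->|/set0P[f0 [Hf0 [V0 _]]]] := eqVneq (piece d) set0.
  by rewrite image_set0.
(* Left division by f0 sends the piece of d into N. *)
apply: (@sub_countable _ _ _
    (act f0 @` [set act h y | h in [set h : gT | H h /\ N h]])).
  apply: subset_card_le => _ [f [Hf [_ W1f]] <-].
  exists (act (f0^-1 * f)%g y); last by rewrite -actM mulgA mulgV mul1g.
  exists (f0^-1 * f)%g => //; split; first exact: HG.
  have -> : (f0^-1 * f)%g = ((d^-1 * f0)^-1 * (d^-1 * f))%g.
    by rewrite invgM invgK mulgA mulgK.
  exact: (VWN (_, _)).
exact: (sub_countable (card_image_le _ _) cN).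
Qed.

End SmallPerturbations.

(** * Trajectories of a word and their perturbations *)

Section Orbits.
Variables (gT : groupType) (M : choiceType) (act : gT -> M -> M).
Hypothesis actM : forall f g x, act (f * g)%g x = act f (act g x).
Hypothesis act1 : forall x, act 1%g x = x.

Lemma actK f : cancel (act f) (act f^-1%g).
Proof. by move=> x; rewrite -actM mulVg act1. Qed.

Lemma act_fixV f x : act f x = x -> act f^-1%g x = x.
Proof. by move=> fx; rewrite -{1}fx actK. Qed.

(** The last letter of a word acts first, so the points visited are the images
    under its suffixes. The latest point comes first, which turns the addition
    of a letter into a [cons]. *)
Fixpoint trajectory (p : gT * gT) (w : seq letter) (x : M) : seq M :=
  if w is a :: w' then
    act (word_eval p.1 p.2 w) x :: trajectory p w' x
  else [:: x].

Lemma head_trajectory p w x z :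
  head z (trajectory p w x) = act (word_eval p.1 p.2 w) x.
Proof. by case: w => //=; rewrite /word_eval big_nil act1. Qed.

Lemma act_word_cons p a w x : act (word_eval p.1 p.2 (a :: w)) x =
  act (letter_eval p.1 p.2 a) (act (word_eval p.1 p.2 w) x).
Proof. by rewrite /word_eval big_cons actM. Qed.

Lemma mem_trajectory p w x : x \in trajectory p w x.
Proof. by elim: w => [|a w IHw] /=; rewrite inE ?eqxx ?IHw ?orbT. Qed.

Lemma act_word_trajectory p w x :
  act (word_eval p.1 p.2 w) x \in trajectory p w x.
Proof.
by rewrite -(head_trajectory _ w x x); case: w => [|a w]; rewrite /= inE eqxx.
Qed.

Lemma act_word_eq_trajectory p q w x :
  trajectory p w x = trajectory q w x ->
  act (word_eval p.1 p.2 w) x = act (word_eval q.1 q.2 w) x.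
Proof. by rewrite -!(head_trajectory _ w x x) => ->. Qed.

(** Only the generator underlying [a] is changed, in such a way that the value
    of the letter [a] itself is multiplied by [h] on the right; when [a] is an
    inverse letter the generator must be multiplied by [h^-1] on the left. *)
Definition perturb (p : gT * gT) (a : letter) (h : gT) : gT * gT :=
  let q x := if a.2 then (h^-1 * x)%g else (x * h)%g in
  if a.1 then (p.1, q p.2) else (q p.1, p.2).

Lemma letter_eval_perturb p a h :
  letter_eval (perturb p a h).1 (perturb p a h).2 a =
    (letter_eval p.1 p.2 a * h)%g.
Proof.
by case: p a => f g [[] []]; rewrite /letter_eval /= ?invgM ?invgK.
Qed.

(** A letter [b] on the generator of [a] is evaluated with [h] applied first if
    [b = a], and with [h^-1] applied last if [b] is the inverse of [a]. Hence
    fixing the source [z] is enough except in the latter case, where the target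
    must be fixed as well. *)
Lemma act_letter_perturb p a h b z : act h z = z ->
  ~~ inverse_letters a b || (act h (act (letter_eval p.1 p.2 b) z) ==
      act (letter_eval p.1 p.2 b) z) ->
  act (letter_eval (perturb p a h).1 (perturb p a h).2 b) z =
    act (letter_eval p.1 p.2 b) z.
Proof.
case: p a b => f g [[] []] [[] []]; rewrite /letter_eval /inverse_letters //=;
  move=> hz /eqP hfz; rewrite ?invgM ?invgK ?actM ?hz //;
  exact: act_fixV.
Qed.

Lemma trajectory_perturb_fix p a h w x :
  {in trajectory p w x, forall z, act h z = z} ->
  trajectory (perturb p a h) w x = trajectory p w x.
Proof.
elim: w => [//|b w IHw] /= hfix.
have hw : {in trajectory p w x, forall z, act h z = z}.
  by move=> z zw; apply: hfix; rewrite inE zw orbT.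
have Ew := IHw hw; rewrite Ew; congr cons.
rewrite !act_word_cons (act_word_eq_trajectory Ew).
apply: act_letter_perturb; first exact: hw (act_word_trajectory _ _ _).
by apply/orP; right; apply/eqP; rewrite -act_word_cons; apply: hfix;
  rewrite inE eqxx.
Qed.

(** The perturbed trajectory feels how [h] moves the end point only if that point
    is the target of a first letter inverse to [a], which is excluded when
    [a :: w] is reduced. This leaves [h] free to move the end point. *)
Lemma trajectory_perturb p a h w x :
  reduced (a :: w) ->
  {in behead (trajectory p w x), forall z, act h z = z} ->
  trajectory (perturb p a h) w x = trajectory p w x.
Proof.
case: w => [//|b w] /= /andP[ab _] hfix.
have Ew := trajectory_perturb_fix a hfix; rewrite Ew; congr cons.
rewrite !act_word_cons (act_word_eq_trajectory Ew).
apply: act_letter_perturb; last by rewrite ab.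
exact: hfix (act_word_trajectory _ _ _).
Qed.

End Orbits.

(** * Generic pairs are free *)

Section FreePairs.
Variables (gT : groupType) (tau : Topological gT) (M : topologicalType).
Let T : topologicalType := Topological.Pack tau.
Variable act : gT -> M -> M.
Hypothesis actM : forall f g x, act (f * g)%g x = act f (act g x).
Hypothesis act1 : forall x, act 1%g x = x.
Hypothesis tauG : group_topology tau.

Lemma perturb_continuous (p : gT * gT) (a : letter) :
  continuous (fun h : T => perturb p a h : T * T).
Proof.
have cl (u : gT) : continuous (fun h : T => ((h : gT)^-1 * u)%g : T).
  apply: (@group_continuousM _ _ tauG T (fun h => ((h : gT)^-1)%g) (fun=> u)).
    by apply: (@group_continuousV _ _ tauG T id) => h; exact: cvg_id.
  by move=> h; exact: cvg_cst.
have cr (u : gT) : continuous (fun h : T => (u * (h : gT))%g : T).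
  apply: (@group_continuousM _ _ tauG T (fun=> u) id).
    by move=> h; exact: cvg_cst.
  by move=> h; exact: cvg_id.
have cc (u : gT) : continuous (fun _ : T => u : T) by move=> h; exact: cvg_cst.
case: a => [[] []] h; rewrite /perturb /=; apply: cvg_pair;
  do ?[exact: cl | exact: cr | exact: cc].
Qed.

Lemma perturb1 (p : gT * gT) (a : letter) : perturb p a 1%g = p.
Proof. by case: p a => f g [[] []]; rewrite /perturb /= ?invg1 ?mul1g ?mulg1. Qed.

Hypothesis sepT : separable T.
Hypothesis M_T1 : accessible_space M.
Hypothesis act_local : forall (U : set M) (y : M), open U -> U y ->
  ~ countable [set act f y | f in [set f | forall x, ~ U x -> act f x = x]].

(** Once the trajectory of [w] is injective, its end point [y] lies in the open
    complement [U] of the earlier points. Small perturbations supported in [U]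
    do not affect it, and among their uncountably many values at [y] only
    finitely many are sent by the letter [a] to a point already visited. *)
Lemma dense_uniq_trajectory (w : seq letter) (x : M) : reduced w ->
  dense [set p : T * T | uniq (trajectory act p w x)].
Proof.
elim: w => [_ O [p Op] _ | a w IHw aw O O0 oO]; first by exists p.
have rw : reduced w by move: aw; rewrite /reduced /=; exact: path_sorted.
have [p [Op /= up]] := IHw rw O O0 oO.
set s := trajectory act p w x in up.
set y := act (word_eval p.1 p.2 w) x.
have sE : s = y :: behead s.
  by rewrite /y -(head_trajectory act1 p w x x) /s; case: (w).
pose U : set M := ~` [set` behead s].
have oU : open U.
  by rewrite openC; apply: (accessible_finite_set_closed.1 M_T1); exact: finite_seq.
have Uy : U y by move: up; rewrite /U sE /= => /andP[/negP].
pose H : set gT := [set f | forall z, ~ U z -> act f z = z].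
have HG f g : H f -> H g -> H (f^-1 * g)%g.
  by move=> Hf Hg z Uz; rewrite actM Hg //; apply: act_fixV => //; exact: Hf.
have N1 : nbhs (1%g : T) [set h : T | O (perturb p a h : T * T)].
  apply: (perturb_continuous (p := p) (a := a)); rewrite /= perturb1.
  exact: (open_nbhs_nbhs (conj oO Op)).
have ncy := uncountable_orbit_near1 tauG sepT actM act1 HG (act_local oU Uy) N1.
(* Bad values of h y lie in the preimage of s under the letter a. *)
have [h [[Hh Oh] hys]] : exists h : gT, (H h /\ O (perturb p a h : T * T)) /\
    act (letter_eval p.1 p.2 a) (act h y) \notin s.
  apply: contrapT => no; apply: ncy.
  apply: (@sub_countable _ _ _ (act (letter_eval p.1 p.2 a)^-1%g @` [set` s])).
    apply: subset_card_le => _ [h Hh <-].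
    exists (act (letter_eval p.1 p.2 a) (act h y)); last exact: actK.
    by apply: contrapT => /negP hs; apply: no; exists h.
  by apply: finite_set_countable; apply: finite_image; exact: finite_seq.
have Es : trajectory act (perturb p a h) w x = s.
  by apply: trajectory_perturb => // z zs; apply: Hh => Uz; exact: Uz.
exists (perturb p a h); split => //=.
rewrite Es up andbT act_word_cons // -(head_trajectory act1 _ w x x) Es.
by rewrite letter_eval_perturb sE /= actM -sE.
Qed.

Lemma comeager_free_pairs (x : M) : closed [set 1%g : T] ->
  comeager [set p : T * T | generates_free_subgroup (p.1 : gT) (p.2 : gT)].
Proof.
move=> cl1.
pose good (w : seq letter) : set (T * T) :=
  [set p : T * T | word_eval (p.1 : gT) (p.2 : gT) w <> 1%g].
have good_open w : open (good w).
  have := (continuousP _).1 (@word_eval_continuous _ _ tauG w) (~` [set 1%g : T]).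
  by apply; rewrite openC.
have good_dense w : reduced w -> w != [::] -> dense (good w).
  case: w => [//|a w] rw _ O O0 oO.
  have [p [Op /= /andP[/negP up _]]] := dense_uniq_trajectory x rw O0 oO.
  exists p; split => // w1; apply: up.
  by rewrite w1 act1; exact: mem_trajectory.
have denseT : dense [set: T * T] by move=> O O0 _; rewrite setIT.
exists (fun k => if unpickle k is Some w then
  if reduced w && (w != [::]) then good w else setT else setT); split.
  move=> k; case: unpickle => [w|]; last by split; [exact: openT|exact: denseT].
  case: ifP => [/andP[rw w0]|_]; last by split; [exact: openT|exact: denseT].
  by split=> //; exact: good_dense.
move=> p Op w rw w0.
by have := Op (pickle w) I; rewrite pickleK rw w0.
Qed.

End FreePairs.

Theorem theorem1p2 (R : realType) (n : nat) (M : topologicalType)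
    (G : groupClosed (homeo M)) (tau : Topological (subgroup G)) :
  topological_manifold R n M ->
  [set: M] !=set0 ->
  local_perturbations G ->
  polish_group_topology R tau ->
  let T : topologicalType := Topological.Pack tau in
  comeager [set p : T * T |
    generates_free_subgroup (p.1 : subgroup G) (p.2 : subgroup G)].
Proof.
move=> [hM _ _] [x _] locG [tauG sepT metT] T.
pose act (f : subgroup G) (y : M) : M := homeo_fun (val f) y.
apply: (@comeager_free_pairs _ tau M act) => //.
- exact: hausdorff_accessible.
- move=> U y oU Uy; rewrite (_ : [set _ | _ in _] = [set f y | f in
      [set f : homeo M | f \in G /\ forall x, ~ U x -> f x = x]]).
    exact: locG.
  apply/seteqP; split=> [_ [f Hf <-]|_ [f [Gf Hf] <-]].
    by exists (val f) => //; split => //; exact: (valP f).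
  by exists (exist _ f Gf).
- exact: completely_metrizable_closed1 metT.
Qed.
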